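(* Let $p>3$ be a prime, let $k$ be the field with $p$ elements, and let $G$ be a finite $p$-group. Let $\mathcal{O}$ be a $p$-obelisk such that $kG\cong k\mathcal{O}$. Then $G$ is a $p$-obelisk.
   Context: For a group $X$, $\gamma_i(X)$ denotes the $i$-th term of the lower central series (with $\gamma_1(X)=X$) and $X^p=\langle x^p\mid x\in X\rangle$. A $p$-obelisk is a finite non-abelian $p$-group $\mathcal{O}$ with $|\mathcal{O}:\gamma_2(\mathcal{O})|=p^2$ and $\mathcal{O}^p=\gamma_3(\mathcal{O})$. $kG$ denotes the group algebra of $G$ over $k$. *)

(* Defs.v *)
From HB Require Import structures.
From mathcomp Require Import all_boot all_order all_algebra.
From mathcomp Require Import all_fingroup all_solvable.

Set Implicit Arguments.
Unset Strict Implicit.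
Unset Printing Implicit Defensive.

Import GRing.Theory.
Local Open Scope ring_scope.

(* Formal k-linear combinations of elements of gT: f stands for the sum of the
   f g *: g. The alias keeps the convolution product defined below apart from
   the pointwise product that finite functions carry in ssralg. *)
Definition group_algebra (k : comNzRingType) (gT : finGroupType) : Type :=
  {ffun gT -> k}.

Section GroupAlgebra.
Variables (k : comNzRingType) (gT : finGroupType).
Local Notation kG := (group_algebra k gT).
Implicit Types (a : k) (f u v : kG) (g h : gT).

HB.instance Definition _ := GRing.Lmodule.copy kG {ffun gT -> k^o}.

Definition galg_one : kG := [ffun g : gT => (g == 1%g)%:R].

(* h * (h^-1 * g) = g enumerates the factorizations of g. *)
Definition galg_mul u v : kG :=
  [ffun g : gT => \sum_(h : gT) u h * v (h^-1 * g)%g].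

Fact galg_mulA : associative galg_mul.
Proof.
move=> u v w; apply/ffunP => g; rewrite !ffunE.
under eq_bigr => h _ do rewrite ffunE big_distrr /=.
under [RHS]eq_bigr => h _ do rewrite ffunE big_distrl /=.
rewrite [RHS]exchange_big /=.
apply: eq_bigr => h _.
rewrite [RHS](reindex_inj (mulgI h)) /=; apply: eq_bigr => h' _.
by rewrite invMg mulKg mulrA !mulgA.
Qed.

Fact galg_mul1l : left_id galg_one galg_mul.
Proof.
move=> u; apply/ffunP => g; rewrite ffunE (bigD1 1%g) //= ffunE eqxx mul1r.
rewrite invg1 mul1g big1 ?addr0 // => h /negPf nh1.
by rewrite ffunE nh1 mul0r.
Qed.

Fact galg_mul1r : right_id galg_one galg_mul.
Proof.
move=> u; apply/ffunP => g; rewrite ffunE (bigD1 g) //= ffunE mulVg eqxx mulr1.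
rewrite big1 ?addr0 // => h nhg.
by rewrite ffunE -eq_mulVg1 (negPf nhg) mulr0.
Qed.

Fact galg_mulDl : left_distributive galg_mul +%R.
Proof.
move=> u v w; apply/ffunP => g; rewrite !ffunE -big_split /=.
by apply: eq_bigr => h _; rewrite ffunE mulrDl.
Qed.

Fact galg_mulDr : right_distributive galg_mul +%R.
Proof.
move=> u v w; apply/ffunP => g; rewrite !ffunE -big_split /=.
by apply: eq_bigr => h _; rewrite ffunE mulrDr.
Qed.

Fact galg_one_neq0 : galg_one != 0 :> kG.
Proof.
by apply/eqP => /ffunP/(_ 1%g)/eqP; rewrite !ffunE eqxx oner_eq0.
Qed.

HB.instance Definition _ := GRing.Zmodule_isNzRing.Build kG
  galg_mulA galg_mul1l galg_mul1r galg_mulDl galg_mulDr galg_one_neq0.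

Fact galg_scaleAl a u v : a *: (u * v) = (a *: u) * v.
Proof.
apply/ffunP => g; rewrite !ffunE scaler_sumr.
by apply: eq_bigr => h _; rewrite ffunE; exact: mulrA.
Qed.

HB.instance Definition _ := GRing.Lmodule_isLalgebra.Build k kG galg_scaleAl.

Fact galg_scaleAr a u v : a *: (u * v) = u * (a *: v).
Proof.
apply/ffunP => g; rewrite !ffunE scaler_sumr.
by apply: eq_bigr => h _; rewrite ffunE; exact: mulrCA.
Qed.

HB.instance Definition _ := GRing.Lalgebra_isAlgebra.Build k kG galg_scaleAr.

End GroupAlgebra.

Definition algebra_iso (k : nzRingType) (A B : algType k) : Prop :=
  exists f : {lrmorphism A -> B}, bijective f.

Definition power_subgroup (gT : finGroupType) (n : nat) (X : {set gT}) :
  {set gT} := <<[set x ^+ n | x in X]>>%g.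

Definition is_obelisk (p : nat) (gT : finGroupType) (X : {group gT}) : Prop :=
  [/\ (p.-group X)%g, ~~ abelian X,
      #|X : 'L_2(X)|%g = (p ^ 2)%N
    & power_subgroup p X = 'L_3(X)%g].

(* Main.v *)
Require Import Defs.
From HB Require Import structures.
From mathcomp Require Import all_boot all_order all_algebra.
From mathcomp Require Import all_fingroup all_solvable all_field.
From mathcomp Require Import mxabelem.

(* Let I be the augmentation ideal. An isomorphism kG -> kO preserves I:
   composed with the augmentation it maps the p-group G into the group of units
   of F_p, which has order prime to p. Comparing the dimensions of the largest
   commutative quotients gives |G : G'| = |O : O'| = p^2, and then
   |'L_2 : 'L_3| = p.

   Since 'L_3(O) = O^p, every element g of 'L_3(O) has g - 1 in I^p, hence in
   I^4, so I is nilpotent of class 2 modulo I^4 as a Lie algebra. This passes to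
   kG, where it says that triple commutators satisfy [x, y, z] - 1 in I^4. If
   'L_3(G) were not contained in G^p, then G would map onto a group of class 3,
   exponent p and order p^4. Conversely, if G^p were not contained in 'L_3(G),
   then G' = G^p 'L_3(G), so all [x, y] - 1 would be in I^3; this passes to the
   quotient O / 'L_3(O), nonabelian of order p^3 and exponent p.

   Both quotients have an abelian maximal subgroup A of exponent p with a
   complement, and are excluded by the following obstruction: the projection to
   A followed by a linear form of A is a polynomial function, of degree at most
   the nilpotency class, and a polynomial function of degree less than n is
   killed by I^n. *)

Set Implicit Arguments.
Unset Strict Implicit.
Unset Printing Implicit Defensive.

Import GRing.Theory.

(** * Powers of the augmentation ideal *)

Section GroupAlgebraTheory.
Local Open Scope ring_scope.
Variables (k : comNzRingType) (gT : finGroupType).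
Local Notation kG := (group_algebra k gT).
Implicit Types (u v w : kG) (g h x y z : gT) (a : k).

Definition gelt g : kG := [ffun h => (h == g)%:R].

Lemma gelt1 : gelt 1%g = 1.
Proof. by []. Qed.

Lemma galg_mulE u v g : (u * v) g = \sum_h u h * v (h^-1 * g)%g.
Proof. by rewrite ffunE. Qed.

Lemma mul_geltE g v h : (gelt g * v) h = v (g^-1 * h)%g.
Proof.
rewrite galg_mulE (bigD1 g) //= ffunE eqxx mul1r big1 ?addr0 // => i /negPf ni.
by rewrite ffunE ni mul0r.
Qed.

Lemma geltM x y : gelt (x * y)%g = gelt x * gelt y.
Proof.
apply/ffunP => h; rewrite mul_geltE !ffunE; congr (nat_of_bool _)%:R.
by rewrite -(inj_eq (mulgI x^-1%g)) mulKg.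
Qed.

Lemma geltX g m : gelt (g ^+ m)%g = gelt g ^+ m.
Proof. by elim: m => // m IHm; rewrite expgS exprS geltM IHm. Qed.

Lemma galg_sum u : u = \sum_g u g *: gelt g.
Proof.
apply/ffunP => h; rewrite sum_ffunE (bigD1 h) //= big1.
  by rewrite !ffunE eqxx addr0 [RHS]mulr1.
by move=> i ni; rewrite !ffunE eq_sym (negPf ni) [LHS]mulr0.
Qed.

Definition galg_lift (A : lalgType k) (rho : gT -> A) u : A :=
  \sum_g u g *: rho g.

Lemma galg_lift_gelt (A : lalgType k) (rho : gT -> A) g :
  galg_lift rho (gelt g) = rho g.
Proof.
rewrite /galg_lift (bigD1 g) //= ffunE eqxx scale1r big1 ?addr0 // => i ni.
by rewrite ffunE (negPf ni) scale0r.
Qed.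

Lemma galg_liftM (A : algType k) (rho : gT -> A) :
    (forall x y, rho (x * y)%g = rho x * rho y) ->
  {morph galg_lift rho : u v / u * v}.
Proof.
move=> rhoM u v; rewrite /galg_lift mulr_suml.
under eq_bigr => g _ do rewrite galg_mulE scaler_suml.
rewrite exchange_big /=; apply: eq_bigr => h _.
rewrite mulr_sumr (reindex_inj (mulgI h)) /=; apply: eq_bigr => g _.
by rewrite mulKg rhoM -scalerAl -scalerAr scalerA.
Qed.

Lemma galg_lift_sum (A : lalgType k) (rho : gT -> A) (I : finType)
    (a : I -> k) (F : I -> kG) :
  galg_lift rho (\sum_i a i *: F i) = \sum_i a i *: galg_lift rho (F i).
Proof.
rewrite /galg_lift; under eq_bigr => g _ do rewrite sum_ffunE scaler_suml.
rewrite exchange_big; apply: eq_bigr => i _ /=; rewrite scaler_sumr.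
by apply: eq_bigr => g _; rewrite ffunE scalerA.
Qed.

Lemma galg_mulC : (forall x y, commute x y) -> forall u v, u * v = v * u.
Proof.
move=> cG u v; apply/ffunP => g; rewrite !galg_mulE.
have inj_inv : injective (fun h : gT => h^-1 * g)%g.
  by move=> x y /mulIg/invg_inj.
rewrite (reindex_inj inj_inv); apply: eq_bigr => h _ /=.
by rewrite mulrC invMg invgK -mulgA (cG h) mulKg.
Qed.

Section CommutativeTarget.
Variables (C : algType k) (rho : gT -> C).
Hypotheses (rhoM : forall x y, rho (x * y)%g = rho x * rho y).
Hypotheses (rho1 : rho 1%g = 1) (cC : forall u v : C, u * v = v * u).
Local Notation G' := ([set: gT]^`(1))%G.

Lemma rho_der1 g : g \in G' -> rho g = 1.
Proof.
case/gen_prodgP=> m [c cG' ->]; elim/big_ind: _ => // [x y|i _].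
  by rewrite rhoM => -> ->; rewrite mulr1.
case/imset2P: (cG' i) => x y _ _ ->; rewrite commgEl conjgE !rhoM.
rewrite [rho y^-1%g * _]cC -!mulrA -(rhoM y) mulgV rho1 mulr1.
by rewrite -rhoM mulVg.
Qed.

(** By [rho_der1], [rho] is constant on the cosets of G', so coefficients add up coset by coset.
    Recording them as a finite function [w] prepares the counting of the image by |G : G'|. *)
Lemma galg_lift_quo_der1 u :
  exists w : {ffun coset_of G' -> k},
    galg_lift rho u = \sum_q w q *: rho (repr q).
Proof.
exists [ffun q => \sum_(g | coset G' g == q) u g].
rewrite /galg_lift (partition_big (coset G') xpredT) //=.
apply: eq_bigr => q _.
rewrite ffunE scaler_suml; apply: eq_bigr => g /eqP <-; congr (_ *: _).
have := mem_repr_coset (coset G' g).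
rewrite val_coset ?(subsetP (der_norm 1 _)) ?inE //.
by case/rcosetP=> x G'x ->; rewrite rhoM (rho_der1 G'x) mul1r.
Qed.

End CommutativeTarget.

Lemma lrmorphism_galg_lift (A : algType k) (f : {lrmorphism kG -> A}) u :
  f u = galg_lift (f \o gelt) u.
Proof.
by rewrite {1}(galg_sum u) linear_sum; apply: eq_bigr => g _; rewrite linearZ.
Qed.

Definition aug u : k := \sum_g u g.

Lemma augM : {morph aug : u v / u * v}.
Proof.
move=> u v; rewrite /aug mulr_suml.
under eq_bigr => g _ do rewrite galg_mulE.
rewrite exchange_big /=; apply: eq_bigr => h _.
rewrite mulr_sumr (reindex_inj (mulgI h)) /=; apply: eq_bigr => g _.
by rewrite mulKg.
Qed.

Lemma augD : {morph aug : u v / u + v}.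
Proof.
by move=> u v; rewrite /aug -big_split; apply: eq_bigr => g _; rewrite ffunE.
Qed.

Lemma augN : {morph aug : u / - u}.
Proof.
by move=> u; rewrite /aug -sumrN; apply: eq_bigr => g _; rewrite ffunE.
Qed.

Lemma aug_gelt g : aug (gelt g) = 1.
Proof.
rewrite /aug (bigD1 g) //= ffunE eqxx big1 ?addr0 // => h /negPf nhg.
by rewrite ffunE nhg.
Qed.

Lemma aug1 : aug 1 = 1.
Proof. exact: (aug_gelt 1%g). Qed.

Lemma aug_geltB1 g : aug (gelt g - 1) = 0.
Proof. by rewrite augD augN aug1 aug_gelt subrr. Qed.

Lemma aug_kernel_sum u : aug u = 0 -> u = \sum_g u g *: (gelt g - 1).
Proof.
move=> u0; under eq_bigr => g _ do rewrite scalerBr.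
by rewrite sumrB -galg_sum -scaler_suml [X in X *: _]u0 scale0r subr0.
Qed.

(* The n-th power of the augmentation ideal, by generators as an additive
   group. *)
Inductive aug_pow : nat -> kG -> Prop :=
| aug_pow0 u : aug_pow 0 u
| aug_powD n u v : aug_pow n u -> aug_pow n v -> aug_pow n (u + v)
| aug_powS n u v : aug u = 0 -> aug_pow n v -> aug_pow n.+1 (u * v).

Lemma aug_powMl n u v : aug_pow n v -> aug_pow n (u * v).
Proof.
elim=> {n v} [v|n v w _ IHv _ IHw|n v w v0 Iw _]; first exact: aug_pow0.
  by rewrite mulrDr; apply: aug_powD.
by rewrite mulrA; apply: aug_powS; rewrite // augM v0 mulr0.
Qed.

Lemma aug_powMr n u v : aug_pow n u -> aug_pow n (u * v).
Proof.
elim=> {n u} [u|n u w _ IHu _ IHw|n u w u0 _ IHw]; first exact: aug_pow0.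
  by rewrite mulrDl; apply: aug_powD.
by rewrite -mulrA; apply: aug_powS.
Qed.

Lemma aug_powN n u : aug_pow n u -> aug_pow n (- u).
Proof. by rewrite -mulN1r; apply: aug_powMl. Qed.

Lemma aug_powB n u v : aug_pow n u -> aug_pow n v -> aug_pow n (u - v).
Proof. by move=> Iu Iv; apply: aug_powD Iu (aug_powN Iv). Qed.

Lemma aug_powZ n a u : aug_pow n u -> aug_pow n (a *: u).
Proof. by rewrite -[u in _ *: u]mul1r scalerAl; apply: aug_powMl. Qed.

Lemma aug_pow_zero n : aug_pow n 0.
Proof.
elim: n => [|n IHn]; first exact: aug_pow0.
rewrite -(mul0r 0); apply: aug_powS => //.
by rewrite /aug big1 // => g _; rewrite ffunE.
Qed.

Lemma aug_powM m n u v : aug_pow m u -> aug_pow n v -> aug_pow (m + n) (u * v).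
Proof.
move=> Iu Iv.
elim: Iu => {m u} [u|m u w _ IHu _ IHw|m u w u0 _ IHw].
- exact: aug_powMl.
- by rewrite mulrDl; apply: aug_powD.
by rewrite -mulrA addSn; apply: aug_powS.
Qed.

Lemma aug_pow_le m n u : (m <= n)%N -> aug_pow n u -> aug_pow m u.
Proof.
move=> le_mn Iu.
elim: Iu m le_mn => {n u} [u|n u v _ IHu _ IHv|n u v u0 _ IHv] m.
- by rewrite leqn0 => /eqP ->; apply: aug_pow0.
- by move=> le_mn; apply: aug_powD; auto.
case: m => [|m] le_mn; first exact: aug_pow0.
by apply: aug_powS => //; apply: IHv.
Qed.

Lemma aug_pow1 u : aug u = 0 -> aug_pow 1 u.
Proof. by move=> u0; rewrite -[u]mulr1; apply: aug_powS (aug_pow0 _). Qed.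

Lemma aug_powX n u : aug u = 0 -> aug_pow n (u ^+ n).
Proof.
move=> u0; elim: n => [|n IHn]; first exact: aug_pow0.
by rewrite exprS; apply: aug_powS.
Qed.

Lemma aug_kernel_ind (P : kG -> Prop) :
    (forall u v, P u -> P v -> P (u + v)) -> (forall a u, P u -> P (a *: u)) ->
  (forall g, P (gelt g - 1)) -> forall u, aug u = 0 -> P u.
Proof.
move=> PD PZ Pg u /aug_kernel_sum ->; elim/big_ind: _ => [|//|g _].
  by rewrite -(scale0r (gelt 1%g - 1)); apply: PZ.
exact: PZ.
Qed.

(* Membership in the n-th dimension subgroup. *)
Definition dim_elt n g := aug_pow n (gelt g - 1).

Lemma dim_elt1 n : dim_elt n 1%g.
Proof. by rewrite /dim_elt gelt1 subrr; apply: aug_pow_zero. Qed.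

Lemma dim_eltM n x y : dim_elt n x -> dim_elt n y -> dim_elt n (x * y)%g.
Proof.
move=> Ix Iy; rewrite /dim_elt geltM.
have ->: gelt x * gelt y - 1 = (gelt x - 1) * gelt y + (gelt y - 1).
  by rewrite mulrBl mul1r addrA subrK.
by apply: aug_powD => //; apply: aug_powMr.
Qed.

Lemma dim_elt_gen n (S : {set gT}) :
  (forall x, x \in S -> dim_elt n x) -> forall x, x \in <<S>>%g -> dim_elt n x.
Proof.
move=> IS _ /gen_prodgP[m [c Sc ->]].
elim/big_ind: _ => [|x y|i _]; [exact: dim_elt1 | exact: dim_eltM |].
exact: IS.
Qed.

(** * Lie products and group commutators *)

Definition lie u v : kG := u * v - v * u.

Lemma lie_addl u v w : lie (u + v) w = lie u w + lie v w.
Proof. by rewrite /lie mulrDl mulrDr opprD addrACA. Qed.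

Lemma lie_addr u v w : lie u (v + w) = lie u v + lie u w.
Proof. by rewrite /lie mulrDl mulrDr opprD addrACA. Qed.

Lemma lie_scalel a u v : lie (a *: u) v = a *: lie u v.
Proof. by rewrite /lie -scalerAl -scalerAr scalerBr. Qed.

Lemma lie_scaler a u v : lie u (a *: v) = a *: lie u v.
Proof. by rewrite /lie -scalerAl -scalerAr scalerBr. Qed.

Lemma lie_subl u v w : lie (u - v) w = lie u w - lie v w.
Proof. by rewrite lie_addl -scaleN1r lie_scalel scaleN1r. Qed.

Lemma lie_subr1 u v : lie (u - 1) (v - 1) = lie u v.
Proof.
by rewrite lie_addl !lie_addr /lie !mulrN !mulNr !mulr1 !mul1r !subrr !addr0.
Qed.

(** In MathComp [x, y] = x^-1 y^-1 x y, hence yx[x, y] = xy. The unit yx does not affect membership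
    in a power of I, so group commutators can be read off from Lie products. *)
Lemma lie_gelt x y :
  lie (gelt x - 1) (gelt y - 1) = gelt (y * x)%g * (gelt [~ x, y]%g - 1).
Proof.
rewrite lie_subr1 /lie mulrBr mulr1 -!geltM commgEl conjgE.
by rewrite !mulgA mulgK mulgV mul1g.
Qed.

Lemma gelt_unitl n g u : aug_pow n (gelt g * u) -> aug_pow n u.
Proof.
move=> Igu; rewrite -[u]mul1r -gelt1 -(mulVg g) geltM -mulrA.
exact: aug_powMl.
Qed.

Lemma dim_eltR m n x y :
  dim_elt m x -> dim_elt n y -> dim_elt (m + n) [~ x, y]%g.
Proof.
move=> Ix Iy; apply: (@gelt_unitl _ (y * x)%g); rewrite -lie_gelt.
by apply: aug_powB; [|rewrite addnC]; apply: aug_powM.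
Qed.

Lemma dim_elt_lcn n g : g \in 'L_n([set: gT])%g -> dim_elt n g.
Proof.
case: n => [_|n]; first exact: aug_pow0.
elim: n g => [|n IHn] g; first by move=> _; apply/aug_pow1/aug_geltB1.
rewrite lcnSn; apply: dim_elt_gen => _ /imset2P[x y Lx _ ->].
by rewrite -addn1; apply: dim_eltR; [apply: IHn | apply/aug_pow1/aug_geltB1].
Qed.

(** In characteristic p, g^p - 1 = (g - 1)^p, because g commutes with 1. *)
Lemma dim_eltX p g : p \in [pchar k]%R -> dim_elt p (g ^+ p)%g.
Proof.
move=> pk; have pkG : p \in [pchar kG]%R.
  apply/andP; split; first exact: pcharf_prime pk.
  by rewrite -[1]scale1r -scaler_nat scalerA mulr1 (pcharf0 pk) scale0r.
rewrite /dim_elt geltX -(pFrobenius_autE pkG).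
rewrite -(pFrobenius_aut1 pkG) -pFrobenius_autB_comm; last exact: commr1.
by rewrite pFrobenius_autE; apply/aug_powX/aug_geltB1.
Qed.

(** The second condition does not mention the group basis, so an isomorphism that preserves the
    augmentation transports it. By bilinearity it may be tested on x - 1 and y - 1, where [lie_gelt]
    applies. *)
Lemma dim_elt_lie n : (forall x y, dim_elt n [~ x, y]%g) <->
  (forall u v, aug u = 0 -> aug v = 0 -> aug_pow n (lie u v)).
Proof.
split=> [Ixy u v u0 v0 | Iuv x y]; last first.
  apply: (@gelt_unitl _ (y * x)%g); rewrite -lie_gelt.
  by apply: Iuv; apply: aug_geltB1.
move: u u0 v v0.
apply: aug_kernel_ind => [u v Iu Iv w w0|a u Iu w w0|x].
- by rewrite lie_addl; apply: aug_powD; auto.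
- by rewrite lie_scalel; apply: aug_powZ; auto.
apply: aug_kernel_ind => [u v Iu Iv|a u Iu|y].
- by rewrite lie_addr; apply: aug_powD; auto.
- by rewrite lie_scaler; apply: aug_powZ; auto.
by rewrite lie_gelt; apply: aug_powMl; exact: Ixy.
Qed.

(* For X = x - 1, Y = y - 1, Z = z - 1 and C = [x, y] - 1, the Lie products
   [[X, Y], Z] and [C, Z] differ in I^4 only. *)
Lemma dim_elt_lie3 :
  (forall x y z, dim_elt 4 [~ x, y, z]%g) <->
  (forall u v w, aug u = 0 -> aug v = 0 -> aug w = 0 ->
     aug_pow 4 (lie (lie u v) w)).
Proof.
have eqXYZ x y z : aug_pow 4
    (lie (lie (gelt x - 1) (gelt y - 1)) (gelt z - 1)
     - gelt (z * [~ x, y])%g * (gelt [~ x, y, z]%g - 1)).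
  (* With s = yx, [lie_gelt] gives [X, Y] = sC, so the difference is [(s - 1)C, Z]; here C is in
     I^2, while s - 1 and Z are in I. *)
  have lieB s C Z : lie (s * C) Z - lie C Z = lie ((s - 1) * C) Z.
    by rewrite mulrBl mul1r lie_subl.
  rewrite lie_gelt -(lie_gelt [~ x, y]%g) lieB.
  have Z0 : aug (gelt z - 1) = 0 by apply: aug_geltB1.
  have I2C : dim_elt 2 [~ x, y]%g.
    by apply: (@dim_eltR 1 1); apply/aug_pow1/aug_geltB1.
  have I3 : aug_pow 3 ((gelt (y * x)%g - 1) * (gelt [~ x, y]%g - 1)).
    by apply: aug_powS => //; apply: aug_geltB1.
  apply: aug_powB; last by apply: aug_powS.
  by rewrite -[4%N]/(3 + 1)%N; apply: aug_powM => //; apply: aug_pow1.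
split=> [Ixyz|Iuvw x y z]; last first.
  apply: (@gelt_unitl _ (z * [~ x, y])%g).
  pose t := lie (lie (gelt x - 1) (gelt y - 1)) (gelt z - 1).
  rewrite -[X in aug_pow _ X](subKr t).
  by apply: aug_powB; [apply: Iuvw; apply: aug_geltB1 | apply: eqXYZ].
move=> u v w u0 v0 w0; move: u u0 v v0 w w0.
apply: aug_kernel_ind => [u v Iu Iv w w0 t t0|a u Iu v v0 w w0|x].
- by rewrite 2!lie_addl; apply: aug_powD; auto.
- by rewrite 2!lie_scalel; apply: aug_powZ; auto.
apply: aug_kernel_ind => [u v Iu Iv w w0|a u Iu w w0|y].
- by rewrite lie_addr lie_addl; apply: aug_powD; auto.
- by rewrite lie_scaler lie_scalel; apply: aug_powZ; auto.
apply: aug_kernel_ind => [u v Iu Iv|a u Iu|z].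
- by rewrite lie_addr; apply: aug_powD; auto.
- by rewrite lie_scaler; apply: aug_powZ; auto.
pose t := gelt (z * [~ x, y])%g * (gelt [~ x, y, z]%g - 1).
rewrite -[X in aug_pow _ X](subrK t).
by apply: aug_powD => //; apply: aug_powMl; exact: Ixyz.
Qed.

End GroupAlgebraTheory.
(** * Isomorphisms of modular group algebras *)

Section ModularIsomorphism.
Local Open Scope ring_scope.

Lemma algebra_iso_inverse (k : nzRingType) (A B : algType k) :
    algebra_iso A B ->
  exists (f : {lrmorphism A -> B}) (f' : {lrmorphism B -> A}),
    cancel f f' /\ cancel f' f.
Proof.
case=> f [f' fK f'K].
pose f'L := GRing.isLinear.Build k B A *:%R f' (can2_linear fK f'K).
pose f'M := GRing.isMonoidMorphism.Build B A f' (can2_monoid_morphism fK f'K).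
pose g : {lrmorphism B -> A} := HB.pack f' f'L f'M.
by exists f, g.
Qed.

Variables (p : nat) (p_prime : prime p).

Lemma Fp_expX (r : 'F_p) m : r ^+ (p ^ m) = r.
Proof.
elim: m => [|m IHm]; first by rewrite expr1.
by rewrite expnSr exprM IHm -[RHS]expf_card card_Fp.
Qed.

Section Morphism.
Variables (gT hT : finGroupType).
Hypothesis pG : (p.-group [set: gT])%g.
Variable f : {lrmorphism group_algebra 'F_p gT -> group_algebra 'F_p hT}.

(** Let |G| = p^m and let r be the augmentation of f(g). Then r = r^(p^m) in F_p, and r^(p^m) = 1
    since g^(p^m) = 1. *)
Lemma aug_lrmorphism u : aug (f u) = aug u.
Proof.
have augX (v : group_algebra 'F_p hT) m : aug (v ^+ m) = aug v ^+ m.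
  elim: m => [|m IHm]; first exact: aug1.
  by rewrite !exprS augM IHm.
have aug_f g : aug (f (gelt _ g)) = 1.
  have [m om] := p_natP pG.
  rewrite -[LHS](Fp_expX _ m) -augX -rmorphXn -geltX.
  by rewrite -om expg_cardG ?inE // gelt1 rmorph1 aug1.
rewrite lrmorphism_galg_lift /galg_lift /aug.
under eq_bigr => h _ do rewrite sum_ffunE.
rewrite exchange_big; apply: eq_bigr => g _ /=.
under eq_bigr => h _ do rewrite ffunE.
by rewrite -mulr_sumr -/(aug _) aug_f mulr1.
Qed.

Lemma aug_pow_lrmorphism n u : aug_pow n u -> aug_pow n (f u).
Proof.
elim=> {n u} [u|n u v _ IHu _ IHv|n u v u0 _ IHv]; first exact: aug_pow0.
  by rewrite linearD; apply: aug_powD.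
by rewrite rmorphM; apply: aug_powS => //; rewrite aug_lrmorphism.
Qed.

Lemma lie_lrmorphism u v : f (lie u v) = lie (f u) (f v).
Proof. by rewrite /lie rmorphB !rmorphM. Qed.

Hypothesis f_surj : forall v, exists u, f u = v.

(* The image of kG in the commutative algebra k[H/H'] is spanned by the images
   of coset representatives of G', so dim k[H/H'] is at most |G : G'|. *)
Lemma leq_index_der1 :
  (#|[set: hT] : [set: hT]^`(1)|%g <= #|[set: gT] : [set: gT]^`(1)|%g)%N.
Proof.
set H' := ([set: hT]^`(1))%G; set G' := ([set: gT]^`(1))%G.
rewrite -!card_quotient ?der_norm // !quotientT !cardsT.
have cC (u v : group_algebra 'F_p (coset_of H')) : u * v = v * u.
  apply: galg_mulC => x y.
  have := der_abelian 0 [set: hT]; rewrite derg0 quotientT => /centsP cQ.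
  by apply: cQ; rewrite inE.
pose gcos h := gelt 'F_p (coset H' h).
have cosM x y : gcos (x * y)%g = gcos x * gcos y.
  by rewrite /gcos morphM ?geltM // (subsetP (der_norm 1 _)) ?inE.
pose th g := galg_lift gcos (f (gelt _ g)).
have thM x y : th (x * y)%g = th x * th y.
  by rewrite /th geltM rmorphM (galg_liftM cosM).
have th1 : th 1%g = 1.
  by rewrite /th gelt1 rmorph1 [LHS](galg_lift_gelt gcos 1%g) /gcos morph1.
pose psi (w : {ffun coset_of G' -> 'F_p}) := \sum_q w q *: th (repr q).
have psi_surj v : exists w, psi w = v.
  have [u1 <-] : exists u, galg_lift gcos u = v.
    exists (\sum_q v q *: gelt _ (repr q)).
    rewrite galg_lift_sum [RHS]galg_sum; apply: eq_bigr => q _.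
    by rewrite galg_lift_gelt /gcos coset_reprK.
  have [u <-] := f_surj u1.
  have [w w_u] := galg_lift_quo_der1 thM th1 cC u.
  by exists w; rewrite -[LHS]w_u lrmorphism_galg_lift galg_lift_sum.
(* Dimensions are compared by counting: the surjection [psi] bounds p^|H : H'| by p^|G : G'|, and a
   section of it gives the required injection. *)
rewrite -(leq_exp2l _ _ (prime_gt1 p_prime)) -(card_Fp p_prime) -!card_ffun.
have [sec secK] := fin_all_exists (psi_surj : forall v : {ffun _ -> _}, _).
exact: (leq_card sec (can_inj secK)).
Qed.

End Morphism.

Section Iso.
Variables (G H : finGroupType).
Hypotheses (pG : (p.-group [set: G])%g) (pH : (p.-group [set: H])%g).
Hypothesis isoGH : algebra_iso (group_algebra 'F_p G) (group_algebra 'F_p H).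

Lemma card_algebra_iso : #|G| = #|H|.
Proof.
have [f fbij] := isoGH; apply/eqP; rewrite -(eqn_exp2l _ _ (prime_gt1 p_prime)).
by rewrite -(card_Fp p_prime) -!card_ffun; apply/eqP/(bij_eq_card fbij).
Qed.

Lemma index_der1_algebra_iso :
  (#|[set: G] : [set: G]^`(1)| = #|[set: H] : [set: H]^`(1)|)%g.
Proof.
have [f [f' [fK f'K]]] := algebra_iso_inverse isoGH.
apply/eqP; rewrite eqn_leq.
apply/andP; split.
  by apply: (leq_index_der1 (f := f')) => v; exists (f v); apply: fK.
by apply: (leq_index_der1 (f := f)) => v; exists (f' v); apply: f'K.
Qed.

Lemma dim_elt_commg_algebra_iso n :
  (forall x y : H, dim_elt 'F_p n [~ x, y]%g) ->
  forall x y : G, dim_elt 'F_p n [~ x, y]%g.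
Proof.
have [f [f' [fK f'K]]] := algebra_iso_inverse isoGH.
move/dim_elt_lie=> In; apply/dim_elt_lie => u v u0 v0.
rewrite -[lie u v]fK; apply: (aug_pow_lrmorphism pH); rewrite lie_lrmorphism.
by apply: In; rewrite (aug_lrmorphism pG).
Qed.

Lemma dim_elt_commg3_algebra_iso :
  (forall x y z : H, dim_elt 'F_p 4 [~ x, y, z]%g) ->
  forall x y z : G, dim_elt 'F_p 4 [~ x, y, z]%g.
Proof.
have [f [f' [fK f'K]]] := algebra_iso_inverse isoGH.
move/dim_elt_lie3=> I4; apply/dim_elt_lie3 => u v w u0 v0 w0.
rewrite -[lie _ w]fK; apply: (aug_pow_lrmorphism pH); rewrite !lie_lrmorphism.
by apply: I4; rewrite (aug_lrmorphism pG).
Qed.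

End Iso.
End ModularIsomorphism.
(** * Polynomial functions on groups *)

Section PolynomialFunctions.
Local Open Scope ring_scope.
Variable k : comNzRingType.

(* Functions of degree less than n for the left difference operators. Extended
   linearly to the group algebra, they kill the n-th power of the augmentation
   ideal. *)
Fixpoint polyfun (gT : finGroupType) n (f : gT -> k) : Prop :=
  if n is m.+1 then forall g, polyfun m (fun h => f (g * h)%g - f h)
  else forall h, f h = 0.

Lemma polyfun_ext (gT : finGroupType) n (f f' : gT -> k) :
  f =1 f' -> polyfun n f -> polyfun n f'.
Proof.
elim: n f f' => [|n IHn] f f' eqf /=; first by move=> f0 h; rewrite -eqf.
by move=> pf g; apply: IHn (pf g) => h; rewrite !eqf.
Qed.

Lemma polyfun_comp (gT hT : finGroupType) (phi : gT -> hT) n (f : hT -> k) :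
    (forall x y, phi (x * y)%g = (phi x * phi y)%g) ->
  polyfun n f -> polyfun n (f \o phi).
Proof.
move=> phiM; elim: n f => [|n IHn] f /= pf; first by move=> h; apply: pf.
by move=> g; apply: polyfun_ext (IHn _ (pf (phi g))) => h /=; rewrite phiM.
Qed.

Lemma aug_pow_polyfun (gT : finGroupType) n (u : group_algebra k gT) f :
  aug_pow n u -> polyfun n f -> \sum_g u g * f g = 0.
Proof.
move=> Iu; elim: Iu f => {n u} [u|n u v _ IHu _ IHv|n u v u0 _ IHv] f pf.
- by rewrite big1 // => g _; rewrite pf mulr0.
- under eq_bigr => g _ do rewrite ffunE mulrDl.
  by rewrite big_split /= IHu // IHv // addr0.
under eq_bigr => g _ do rewrite galg_mulE mulr_suml.
rewrite exchange_big /=.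
(* Write f(hg) = (f(hg) - f(g)) + f(g). The difference has lower degree, so [v] kills it; summed
   over [h], the rest carries the factor [aug u], which is 0. *)
have shift h : \sum_g u h * v (h^-1 * g)%g * f g = u h * \sum_g v g * f g.
  rewrite mulr_sumr (reindex_inj (mulgI h)) /=.
  under eq_bigr => g _.
    rewrite mulKg -(subrK (f g) (f (h * g)%g)) -mulrA mulrDr mulrDr; over.
  by rewrite big_split /= -mulr_sumr (IHv _ (pf h)) mulr0 add0r.
under eq_bigr => h _ do rewrite shift.
by rewrite -mulr_suml [X in X * _]u0 mul0r.
Qed.

Lemma dim_elt_polyfun (gT : finGroupType) n (g : gT) (f : gT -> k) :
  dim_elt k n g -> polyfun n f -> f g = f 1%g.
Proof.
move=> Ig pf; apply/eqP; rewrite -subr_eq0 -(aug_pow_polyfun Ig pf).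
have sum_gelt x : \sum_h gelt k x h * f h = f x.
  rewrite (bigD1 x) //= ffunE eqxx mul1r big1 ?addr0 // => h /negPf nhx.
  by rewrite ffunE nhx mul0r.
rewrite -(sum_gelt g) -(sum_gelt 1%g) -sumrB.
by apply/eqP/eq_bigr => h _; rewrite -mulrBl gelt1 !ffunE.
Qed.

End PolynomialFunctions.

(** * The projection of a semidirect product onto its normal factor *)

Section AbelianMaximal.
Local Open Scope group_scope.
Variables (p : nat) (gT : finGroupType) (A X : {group gT}).
Hypothesis defG : A ><| X = [set: gT].
Local Notation G := [set: gT].

(* If lam kills A :&: 'L_m.+1, the left difference by b * s of such a function
   is a function of the same form for a |-> lam [~ a, s^-1], which kills
   A :&: 'L_m. *)
Lemma polyfun_divgr m (c : 'F_p) (lam : gT -> 'F_p) :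
    {in A &, {morph lam : a b / a * b >-> (a + b)%R}} ->
    {in A :&: 'L_m.+1(G), forall a, lam a = 0%R} ->
  polyfun m.+1 (fun h => c + lam (divgr A X h))%R.
Proof.
have [/andP[sAG nAG] sXG /= eqAX _ tiAX] := sdprod_context defG.
elim: m c lam => [|m IHm] c lam lamM lamL g.
  have Adiv h : divgr A X h \in A by rewrite mem_divgr // eqAX inE.
  by move=> h /=; rewrite !lamL ?subrr // inE Adiv inE.
have AJ a x : a \in A -> a ^ x \in A by rewrite memJ_norm // (subsetP nAG) ?inE.
have Adiv h : divgr A X h \in A by rewrite mem_divgr // eqAX inE.
have Xrem h : remgr A X h \in X by rewrite mem_remgr // eqAX inE.
pose s := remgr A X g; pose lam' a := (lam (a ^ s^-1)%g - lam a)%R.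
apply: (@polyfun_ext 'F_p _ _
  (fun h => lam (divgr A X g) + lam' (divgr A X h)))%R.
  move=> h; set b := divgr A X g; set a := divgr A X h.
  (* For g = bs and h = ar, with a, b in A and r, s in X, the product gh is (b a^(s^-1))(sr). *)
  have -> : divgr A X (g * h) = b * a ^ s^-1.
    have -> : g * h = b * a ^ s^-1 * (s * remgr A X h).
      have mulJ (x y z t : gT) : x * y * (z * t) = x * z ^ y^-1 * (y * t).
        by rewrite conjgE invgK !mulgA mulgKV.
      by rewrite -mulJ -!divgr_eq.
    exact: (divgrMid tiAX (groupM (Adiv g) (AJ _ _ (Adiv h)))
                          (groupM (Xrem g) (Xrem h))).
  rewrite (lamM _ _ (Adiv g) (AJ _ _ (Adiv h))) /lam'.
  by rewrite addrA (addrC c) addrKA.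
apply: IHm => [a b Aa Ab | a /setIP[Aa La]]; rewrite /lam'.
  rewrite conjMg (lamM _ _ Aa Ab) (lamM _ _ (AJ _ _ Aa) (AJ _ _ Ab)).
  by rewrite opprD addrACA.
(* This turns [lam' a] into [lam] of [a, s^-1], which lies one term further down the lower central
   series than a. *)
have eq_a : a ^ s^-1 = a * [~ a, s^-1] by rewrite commgEl mulKVg.
have Aas : [~ a, s^-1] \in A by rewrite commgEl groupM ?groupV ?AJ.
rewrite eq_a lamM // (lamL [~ a, s^-1]) ?addr0 ?subrr //.
by rewrite inE Aas lcnSn mem_commg ?inE.
Qed.

End AbelianMaximal.

Lemma exponent_pgroup (p : nat) (gT : finGroupType) :
    prime p -> (forall x : gT, x ^+ p = 1)%g ->
  forall H : {group gT}, (p.-group H)%g.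
Proof.
move=> p_prime expG H; apply/pgroupP=> q q_pr /(Cauchy q_pr)[x _ ox].
by rewrite inE -dvdn_prime2 // -ox order_dvdn expG.
Qed.

Section PolyTrivial.
Local Open Scope group_scope.
Variables (p : nat) (p_prime : prime p).

(** What [dim_elt_polyfun] yields for z in the n-th dimension subgroup. In this form it passes to
    quotients by composing functions with the projection. *)
Definition poly_trivial (gT : finGroupType) n (z : gT) :=
  forall f : gT -> 'F_p, polyfun n f -> f z = f 1.

Lemma poly_trivial_coset (gT : finGroupType) (N : {group gT}) n z :
  [set: gT] \subset 'N(N) -> poly_trivial n z -> poly_trivial n (coset N z).
Proof.
move=> nN Pz f pf; rewrite -(morph1 (coset N)).
apply: (Pz (f \o coset N)); apply: polyfun_comp pf => x y.
by rewrite morphM // (subsetP nN) ?inE.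
Qed.

(** An element outside A generates a complement of order p. If z were nontrivial, some coordinate of
    A over F_p would not vanish at z; extended by [polyfun_divgr], it would be a polynomial function
    separating z from 1. *)
Lemma poly_trivial_abelian (gT : finGroupType) (A : {group gT}) n z :
    (forall x : gT, x ^+ p = 1) -> abelian A -> #|[set: gT] : A| = p ->
    'L_n.+1([set: gT]) = 1 -> z \in A -> poly_trivial n.+1 z ->
  z = 1.
Proof.
move=> expG abA iA Ln Az Pz.
have pG := exponent_pgroup p_prime expG.
have maxA : maximal A [set: gT] by rewrite p_index_maximal ?subsetT ?iA.
have nsA : A <| [set: gT] by apply: p_maximal_normal (pG _) maxA.
have [x _ nAx] : exists2 x, x \in [set: gT] & x \notin A.
  by apply/subsetPn; apply: (proper_subn (maxgroupp maxA)).
have x1 : x != 1 by apply: contraNneq nAx => ->.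
have ox : #[x] = p by apply: nt_prime_order.
have tiAX : A :&: <[x]> = 1.
  by rewrite setIC prime_TIg ?cycle_subG // -orderE ox.
have defG : A ><| <[x]> = [set: gT].
  rewrite sdprodE ?(subset_trans (subsetT _) (normal_norm nsA)) //.
  rewrite -norm_joinEr ?(subset_trans (subsetT _) (normal_norm nsA)) //.
  have [_ maxP] := maxgroupP maxA; apply/eqP; rewrite eqEsubset subsetT /=.
  apply/negPn/negP=> nsub; case/negP: nAx.
  rewrite -(maxP (A <*> <[x]>)%G); first by rewrite -cycle_subG joing_subr.
    by rewrite properE subsetT.
  exact: joing_subl.
have abelA : p.-abelem A.
  by rewrite abelemE // abA; apply/exponentP => a _; apply: expG.
apply/eqP/negPn/negP=> z1.
have ntA : A :!=: 1 by apply/trivgPn; exists z.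
have [j lamz] : exists j, (abelem_rV abelA ntA z ord0 j != 0)%R.
  apply/existsP; apply: contraR z1; rewrite negb_exists => /forallP z0.
  apply/eqP; apply: (@abelem_rV_inj p gT A abelA ntA) => //.
  rewrite abelem_rV_1; apply/rowP=> j; rewrite mxE.
  by apply/eqP/negPn/z0.
pose lam a : 'F_p := abelem_rV abelA ntA a ord0 j.
have lam1 : lam 1 = 0%R by rewrite /lam abelem_rV_1 mxE.
have lamM : {in A &, {morph lam : a b / a * b >-> (a + b)%R}}.
  by move=> a b Aa Ab; rewrite /lam abelem_rV_M // mxE.
have := Pz _ (polyfun_divgr (m := n) defG 0%R lamM _).
rewrite !divgr_id // lam1 !add0r => lamz0; case/eqP: lamz; apply: lamz0.
by move=> a; rewrite Ln => /setIP[_ /set1P ->].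
Qed.

End PolyTrivial.
(** * p-groups with a commutator subgroup of index p^2 *)

Section TwoGeneratedPGroups.
Local Open Scope group_scope.
Variables (p : nat) (p_prime : prime p).

Lemma lcn_proper (gT : finGroupType) (G : {group gT}) n :
  nilpotent G -> 'L_n.+1(G) \subset 'L_n.+2(G) -> 'L_n.+1(G) = 1.
Proof.
move=> nilG sL; apply/eqP; apply: contraT => ntL.
have : 'L_n.+2(G) \proper 'L_n.+1(G).
  rewrite lcnSn; apply: (nil_comm_properl nilG) ntL _; first exact: lcn_sub.
  by rewrite subsetI subxx lcn_norm.
by case/andP=> _; rewrite sL.
Qed.

Section DerivedIndex.
Variables (gT : finGroupType) (G : {group gT}).
Hypotheses (pG : p.-group G) (iG : #|G : G^`(1)| = (p ^ 2)%N).
Hypothesis nabG : ~~ abelian G.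

(** A group of order p^2 is abelian, and cyclic unless its exponent divides p. A nilpotent group
    with cyclic G / G' is itself cyclic, which [nabG] excludes. *)
Lemma abelem_quo_der1 : p.-abelem (G / G^`(1)).
Proof.
have oQ : #|G / G^`(1)| = (p ^ 2)%N by rewrite card_quotient ?der_norm.
rewrite abelemE // (card_p2group_abelian p_prime) //=.
apply/exponentP => x Qx.
have : #[x] %| (p ^ 2)%N by rewrite -oQ order_dvdG.
case/(dvdn_pfactor _ _ p_prime)=> [[|[|m]] le_m ox].
- by move/eqP: ox; rewrite order_eq1 => /eqP ->; rewrite expg1n.
- by rewrite -(expn1 p) -ox expg_order.
case/negP: nabG; apply: cyclic_abelian.
apply: cyclic_nilpotent_quo_der1_cyclic; first exact: pgroup_nil pG.
apply/cyclicP; exists x; apply/eqP; rewrite eq_sym eqEcard cycle_subG Qx.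
by rewrite -orderE ox oQ (leq_exp2l _ _ (prime_gt1 p_prime)).
Qed.

Lemma Phi_der1 : 'Phi(G) = G^`(1).
Proof.
apply/eqP; rewrite eqEsubset (Phi_min pG (der_norm 1 G) abelem_quo_der1).
by rewrite (Phi_joing pG) joing_subl.
Qed.

Lemma Mho_sub_der1 : 'Mho^1(G) \subset G^`(1).
Proof. by rewrite -Phi_der1 (Phi_joing pG) joing_subr. Qed.

Lemma expgp_der1 x : x \in G -> x ^+ p \in G^`(1).
Proof.
move=> Gx; apply: (subsetP Mho_sub_der1).
by rewrite -[p]expn1 (Mho_p_elt 1 Gx) ?(mem_p_elt pG).
Qed.

(** Burnside's basis theorem: G' is the Frattini subgroup and G / G' has rank 2, so lifts of two
    generators of G / G' generate G. *)
Lemma two_generators : exists x y, G :=: <[x]> <*> <[y]>.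
Proof.
have oQ : #|G / G^`(1)| = (p ^ 2)%N by rewrite card_quotient ?der_norm.
have [B genB oB] := grank_witness (G / G^`(1)).
have cB : #|B| == 2.
  rewrite oB grank_abelian ?(abelem_abelian abelem_quo_der1) //.
  by rewrite (rank_abelem abelem_quo_der1) oQ pfactorK.
have [xb [yb [_ defB]]] := cards2P _ cB.
have [xbQ ybQ] : xb \in G / G^`(1) /\ yb \in G / G^`(1).
  by rewrite -genB defB !mem_gen // !inE eqxx ?orbT.
have [[x Nx Gx def_x] [y Ny Gy def_y]] := (morphimP xbQ, morphimP ybQ).
exists x, y; have sxyG : [set x; y] \subset G by rewrite subUset !sub1set Gx.
have defQ : G / G^`(1) = <<[set x; y]>> / G^`(1).
  rewrite quotient_gen ?(subset_trans sxyG (der_norm 1 G)) //.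
  by rewrite quotientU !quotient_set1 // -genB defB def_x def_y.
have sGxy : G \subset 'Phi(G) <*> [set x; y].
  rewrite Phi_der1 -joing_idr.
  apply: subset_trans (mul_subG (joing_subl _ _) (joing_subr _ _)).
  by rewrite -quotientSK ?der_norm // -defQ.
rewrite -[LHS](@Phi_nongen _ G [set x; y]) ?joing_idl ?joing_idr //.
apply/eqP; rewrite eqEsubset sGxy andbT join_subG sxyG andbT.
exact: Phi_sub.
Qed.

(** Modulo ['L_3(G)] the commutator subgroup is central and generated by [x, y], for generators x, y
    of G. Since x^p is in G', [x, y]^p = [x^p, y] = 1 there. Index 1 would make the nilpotent group
    G abelian. *)
Lemma index_lcn3 : #|'L_2(G) : 'L_3(G)| = p.
Proof.
have [x [y defG]] := two_generators.
have nL : G \subset 'N('L_3(G)) by apply: lcn_norm.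
have [Gx Gy] : x \in G /\ y \in G.
  by rewrite defG; split; rewrite -cycle_subG (joing_subl, joing_subr).
pose xb := coset 'L_3(G) x; pose yb := coset 'L_3(G) y.
have defQ : G / 'L_3(G) = <[xb]> <*> <[yb]>.
  have quoE (N : {group gT}) :
      G \subset 'N(N) -> G / N = <[coset N x]> <*> <[coset N y]>.
    move=> nN; rewrite defG quotientY ?cycle_subG ?(subsetP nN) //.
    by rewrite !quotient_cycle ?(subsetP nN).
  exact: quoE.
have cL2 : 'L_2(G) / 'L_3(G) \subset 'C(G / 'L_3(G)).
  by apply: subset_trans (lcn_central 2 G) _; rewrite subsetIr.
have L2E : 'L_2(G) / 'L_3(G) = (G / 'L_3(G))^`(1) by rewrite -quotient_der.
have defL2 : 'L_2(G) / 'L_3(G) = <[[~ xb, yb]]>.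
  rewrite L2E defQ; apply: der1_joing_cycles; rewrite -defQ.
  by apply: (subsetP cL2); rewrite L2E mem_commg ?mem_quotient.
have cxy z w : z \in 'L_2(G) / 'L_3(G) -> w \in G / 'L_3(G) -> commute z w.
  by move=> Lz Gw; apply: (centsP cL2).
have : #|'L_2(G) : 'L_3(G)| %| p.
  rewrite -card_quotient ?(subset_trans (lcn_sub 2 G)) // defL2 -orderE.
  rewrite order_dvdn.
  have Qx : xb \in G / 'L_3(G) by apply: mem_quotient.
  have Qy : yb \in G / 'L_3(G) by apply: mem_quotient.
  rewrite -commXg; last by apply/commute_sym/cxy; rewrite ?L2E ?mem_commg.
  rewrite -morphX ?(subsetP nL) //; apply/commgP/cxy => //.
  by apply/mem_quotient/expgp_der1.
case/primeP: p_prime => _ dvdp /dvdp/pred2P[] // i1.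
have nilG := pgroup_nil pG.
case/negP: nabG; apply/derG1P; apply: (lcn_proper (n := 1) nilG).
by rewrite -indexg_eq1 i1.
Qed.

Lemma eq_lcn2 (K : {group gT}) :
  'L_3(G) \proper K -> K \subset 'L_2(G) -> K :=: 'L_2(G).
Proof.
case/andP=> sLK nsKL sKL; have := Lagrange_index sKL sLK.
rewrite index_lcn3 => eqp.
have := dvdn_mull #|'L_2(G) : K| (dvdnn #|K : 'L_3(G)|).
rewrite eqp; case/primeP: p_prime => _ dvdp /dvdp/pred2P[i1|ip].
  by case/negP: nsKL; rewrite -indexg_eq1 i1.
move/eqP: eqp; rewrite ip -{2}(mul1n p) eqn_pmul2r ?prime_gt0 // indexg_eq1.
by move=> sLK'; apply/eqP; rewrite eqEsubset sKL.
Qed.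

End DerivedIndex.

Section ExponentP.
Variable gT : finGroupType.
Local Notation G := [set: gT].
Hypotheses (expG : forall x : gT, x ^+ p = 1).
Hypothesis iG : #|G : G^`(1)| = (p ^ 2)%N.

(* The centralizer of c is abelian of index p and contains G'. *)
Lemma poly_trivial_der1 (c : gT) (N : {group gT}) n z :
    #|N| = p -> (forall x, [~ c, x] \in N) -> c \notin 'Z(G) ->
    G^`(1) \subset 'C('C[c]) -> 'L_n.+1(G) = 1 ->
  z \in G^`(1) -> poly_trivial p n.+1 z -> z = 1.
Proof.
move=> oN cN ncZ cG' Ln G'z; pose A := 'C[c]%G.
have sG'A : G^`(1) \subset 'C[c].
  apply: subset_trans cG' _; rewrite -(cent_set1 c) centS // sub1set cent_set1.
  exact/cent1P.
have iA : #|G : A| = p.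
  (* All conjugates of c lie in the coset cN, which has p elements. *)
  have le_iA : (#|G : A| <= p)%N.
    rewrite -(setTI A) index_cent1 -oN -(card_lcoset N c) subset_leq_card //.
    by apply/subsetP=> _ /imsetP[x _ ->]; rewrite mem_lcoset cN.
  have [m om] : exists m, #|G : A| = (p ^ m)%N.
    have /p_natP[m om] : p.-nat #|G : A|.
      apply: pnat_dvd (dvdn_indexg _ _) _.
      exact: exponent_pgroup p_prime expG [group of G].
    by exists m.
  move: le_iA; rewrite om -{2}(expn1 p) (leq_exp2l _ _ (prime_gt1 p_prime)).
  case: m om => [|[|//]] // i1 _; case/negP: ncZ.
  move/eqP: i1; rewrite indexg_eq1 => sGA; rewrite inE inE /=.
  by apply/centP=> x Gx; apply/commute_sym/cent1P; apply: (subsetP sGA).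
apply: (@poly_trivial_abelian p p_prime gT A) => //; last exact: (subsetP sG'A).
(* A is abelian: G' is central in A, and A / G' is cyclic of order p because |G : G'| = p^2 and |G :
   A| = p. *)
apply: (@cyclic_factor_abelian _ (G^`(1))%G); first by rewrite subsetI sG'A.
apply: prime_cyclic.
rewrite card_quotient ?(subset_trans (subsetT _) (der_norm 1 G)) //.
have := Lagrange_index (subsetT A) sG'A.
rewrite iG iA => /eqP.
by rewrite expnS eqn_pmul2l ?prime_gt0 // expn1 => /eqP ->.
Qed.

End ExponentP.
End TwoGeneratedPGroups.

(** * Passage to quotient groups *)

Section Quotients.
Local Open Scope group_scope.
Variables (gT : finGroupType) (N : {group gT}).
Hypothesis nN : [set: gT] \subset 'N(N).

Lemma lcn_cosetT n : 'L_n([set: coset_of N]) = 'L_n([set: gT]) / N.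
Proof. by rewrite -quotientT; apply/esym/morphim_lcn. Qed.

Lemma index_der1_cosetT :
    N \subset [set: gT]^`(1) ->
  #|[set: coset_of N] : [set: coset_of N]^`(1)|
    = #|[set: gT] : [set: gT]^`(1)|.
Proof.
move=> sN; rewrite [_^`(1)](lcn_cosetT 2) -quotientT index_quotient_eq //.
  by rewrite setTI.
exact: lcn_sub.
Qed.

Lemma expg_cosetT m :
  (forall x : gT, x ^+ m \in N) -> forall x : coset_of N, x ^+ m = 1.
Proof.
move=> expN x; have Nx : repr x \in 'N(N) by rewrite (subsetP nN) ?inE.
by rewrite -(coset_reprK x) -morphX //; apply/coset_id/expN.
Qed.

Lemma coset_commg x y : coset N [~ x, y] = [~ coset N x, coset N y].
Proof. by rewrite morphR // (subsetP nN) ?inE. Qed.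

Lemma poly_trivial_commg3_cosetT p n :
    (forall x y z : gT, poly_trivial p n [~ x, y, z]) ->
  forall x y z : coset_of N, poly_trivial p n [~ x, y, z].
Proof.
move=> Pw x y z; rewrite -(coset_reprK x) -(coset_reprK y) -(coset_reprK z).
by rewrite -!coset_commg; apply: poly_trivial_coset.
Qed.

End Quotients.

(** * The third lower central term and the p-th powers *)

Section Obelisks.
Local Open Scope group_scope.
Variables (p : nat) (p_prime : prime p).

Lemma lcn3_neq1_nonabelian (gT : finGroupType) (G : {group gT}) :
  'L_3(G) != 1 -> ~~ abelian G.
Proof.
apply: contraNN => /derG1P G'1; rewrite -subG1 -G'1; exact: (lcn_subS 2).
Qed.

Lemma lcn3_eq1 (gT : finGroupType) :
  (forall x y z : gT, [~ x, y, z] = 1) -> 'L_3([set: gT]) = 1.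
Proof.
move=> c1; apply/commG1P; rewrite gen_subG.
apply/subsetP=> _ /imset2P[x y _ _ ->]; apply/centP=> z _.
by apply/commgP; rewrite c1.
Qed.

(** Suppose the order is p. A noncentral c in ['L_2] generates G' together with the central subgroup
    ['L_3], so G' centralizes the centralizer of c. Then [poly_trivial_der1] with N = ['L_3] kills
    all triple commutators. *)
Lemma poly_trivial_commg3_lcn3 (gT : finGroupType) :
    (forall x : gT, x ^+ p = 1) -> 'L_4([set: gT]) = 1 ->
    #|[set: gT] : [set: gT]^`(1)| = (p ^ 2)%N ->
    (forall x y z : gT, poly_trivial p 4 [~ x, y, z]) ->
  #|'L_3([set: gT])| != p.
Proof.
move=> expG L4 iG Pxyz; apply/eqP=> oL3.
have ntL3 : 'L_3([set: gT]) != 1.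
  by rewrite -cardG_gt1 oL3 prime_gt1.
have pG := exponent_pgroup p_prime expG [set: gT].
have nabG := lcn3_neq1_nonabelian ntL3.
have cL3 : 'L_3([set: gT]) \subset 'C([set: gT]) by apply/commG1P.
have [c L2c ncZ] : exists2 c, c \in 'L_2([set: gT]) & c \notin 'C([set: gT]).
  by apply/subsetPn; apply: contraNN ntL3 => cL2; apply/eqP/commG1P.
have defL2 : 'L_3([set: gT]) <*> <[c]> = 'L_2([set: gT]).
  apply: (eq_lcn2 p_prime pG iG nabG (K := 'L_3([set: gT]) <*> <[c]>)).
    rewrite properE joing_subl join_subG subxx /= cycle_subG.
    by apply: contraNN ncZ => L3c; apply: (subsetP cL3).
  by rewrite join_subG lcn_subS cycle_subG.
case/eqP: ntL3; apply: lcn3_eq1 => x y z.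
apply: (poly_trivial_der1 p_prime expG iG (c := c) oL3 (n := 3)) => //.
- by move=> t; rewrite mem_commg ?inE.
- by rewrite inE inE.
- rewrite -[_^`(1)]/'L_2(_) -defL2 join_subG cycle_subG.
  rewrite (subset_trans cL3) ?centS ?subsetT //=.
  by apply/centP=> t /cent1P/commute_sym.
apply: (subsetP (lcn_subS 2 _)).
by rewrite !mem_commg ?inE.
Qed.

(** Here ['L_3] is central, so a maximal subgroup M of it is normal in the whole group. Factoring
    out M would leave a third term of order p, which [poly_trivial_commg3_lcn3] excludes. *)
Lemma poly_trivial_lcn3_class3 (gT : finGroupType) :
    (forall x : gT, x ^+ p = 1) -> 'L_4([set: gT]) = 1 ->
    #|[set: gT] : [set: gT]^`(1)| = (p ^ 2)%N ->
    (forall x y z : gT, poly_trivial p 4 [~ x, y, z]) ->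
  'L_3([set: gT]) = 1.
Proof.
move=> expG L4 iG Pxyz.
have cL3 : 'L_3([set: gT]) \subset 'C([set: gT]) by apply/commG1P.
have [<-//|[M maxM _]] := maximal_exists (sub1G 'L_3([set: gT])).
have sML3 := proper_sub (maxgroupp maxM).
have pL3 := exponent_pgroup p_prime expG 'L_3([set: gT]).
have nM : [set: gT] \subset 'N(M).
  by rewrite cents_norm // centsC (subset_trans sML3).
have sMG' : M \subset [set: gT]^`(1).
  by apply: subset_trans sML3 (lcn_subS 2 _).
have := @poly_trivial_commg3_lcn3 (coset_of M).
rewrite !lcn_cosetT // index_der1_cosetT // L4 quotient1.
rewrite card_quotient ?(subset_trans (subsetT _) nM) //.
rewrite (p_maximal_index pL3 maxM) eqxx => absurd.
have: false; last by []. apply: absurd => //.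
- by apply: (expg_cosetT) => // x; rewrite expG group1.
exact: poly_trivial_commg3_cosetT.
Qed.

(** The previous lemma, applied modulo ['L_4], puts ['L_3] inside ['L_4]; in a nilpotent group this
    makes ['L_3] trivial. *)
Lemma poly_trivial_lcn3 (gT : finGroupType) :
    (forall x : gT, x ^+ p = 1) ->
    #|[set: gT] : [set: gT]^`(1)| = (p ^ 2)%N ->
    (forall x y z : gT, poly_trivial p 4 [~ x, y, z]) ->
  'L_3([set: gT]) = 1.
Proof.
move=> expG iG Pxyz.
have nL4 : [set: gT] \subset 'N('L_4([set: gT])) := lcn_norm 4 _.
apply: lcn_proper.
  exact: pgroup_nil (exponent_pgroup p_prime expG _).
rewrite -quotient_sub1 ?(subset_trans (subsetT _) nL4) //.
rewrite -(lcn_cosetT nL4) poly_trivial_lcn3_class3 //.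
- by apply: (expg_cosetT) => // x; rewrite expG group1.
- by rewrite lcn_cosetT // trivg_quotient.
- rewrite index_der1_cosetT //.
  exact: subset_trans (lcn_subS 3 _) (lcn_subS 2 _).
exact: poly_trivial_commg3_cosetT.
Qed.

Section WholeGroup.
Variable gT : finGroupType.
Local Notation G := [set: gT].
Hypotheses (pG : p.-group G) (iG : #|G : G^`(1)| = (p ^ 2)%N).
Hypothesis nabG : ~~ abelian G.

Lemma expgp_Mho (x : gT) : x ^+ p \in 'Mho^1(G).
Proof.
by have := Mho_p_elt 1 (in_setT x) (mem_p_elt pG (in_setT x)); rewrite expn1.
Qed.

(** The quotient by ['Mho^1(G)] satisfies x^p = 1, and its commutator subgroup still has index p^2
    because ['Mho^1(G)] lies in G'. So [poly_trivial_lcn3] applies to it. *)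
Lemma lcn3_sub_Mho :
  (forall x y z : gT, dim_elt 'F_p 4 [~ x, y, z]) -> 'L_3(G) \subset 'Mho^1(G).
Proof.
move=> D4; have nM : G \subset 'N('Mho^1(G)) := char_norm (Mho_char 1 _).
rewrite -quotient_sub1 ?(subset_trans (subsetT _) nM) //.
rewrite -(lcn_cosetT nM) poly_trivial_lcn3 //.
- by apply: (expg_cosetT) => // x; apply: expgp_Mho.
- by rewrite index_der1_cosetT //; apply: (Mho_sub_der1 p_prime).
apply: poly_trivial_commg3_cosetT => // x y z f.
exact: dim_elt_polyfun.
Qed.

Lemma dim_elt_Mho (x : gT) : x \in 'Mho^1(G) -> dim_elt 'F_p p x.
Proof.
rewrite (MhoE 1 pG); apply: dim_elt_gen => _ /imsetP[y _ ->].
by rewrite expn1; apply/dim_eltX/pchar_Fp.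
Qed.

(** Otherwise ['L_3(G)] and ['Mho^1(G)] generate ['L_2(G)], as the index p leaves no room in
    between. Both lie in the third dimension subgroup, the second one because p is at least 3. *)
Lemma Mho_sub_lcn3 :
    (2 < p)%N -> ~ (forall x y : gT, dim_elt 'F_p 3 [~ x, y]) ->
  'Mho^1(G) \subset 'L_3(G).
Proof.
move=> p_gt2 nD3; apply/negPn/negP=> nsML; case: nD3 => x y.
have : [~ x, y] \in 'L_2(G) by rewrite mem_commg ?inE.
have <- : 'L_3(G) <*> 'Mho^1(G) = 'L_2(G).
  apply: (eq_lcn2 p_prime pG iG nabG (K := 'L_3(G) <*> 'Mho^1(G))).
    by rewrite properE joing_subl join_subG subxx.
  by rewrite join_subG lcn_subS; apply: (Mho_sub_der1 p_prime).
apply: dim_elt_gen => z /setUP[]; first exact: dim_elt_lcn.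
by move/dim_elt_Mho; apply: aug_pow_le.
Qed.

(** The quotient Q by ['L_3(G)] is nonabelian of order p^3 and exponent p. For any noncentral c,
    [poly_trivial_der1] with N = Q' would make all commutators of Q trivial. *)
Lemma dim_elt_commg_lcn3 :
  'Mho^1(G) \subset 'L_3(G) -> ~ (forall x y : gT, dim_elt 'F_p 3 [~ x, y]).
Proof.
move=> sML D3; have nL : G \subset 'N('L_3(G)) := lcn_norm 3 _.
pose Q := coset_of 'L_3(G).
have L3 : 'L_3([set: Q]) = 1 by rewrite lcn_cosetT // trivg_quotient.
have oQ' : #|[set: Q]^`(1)| = p.
  rewrite -[_^`(1)]/('L_2(_)) lcn_cosetT // card_quotient.
    exact: index_lcn3.
  exact: subset_trans (subsetT _) nL.
have cQ' : [set: Q]^`(1) \subset 'C([set: Q]) by apply/commG1P.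
have expQ : forall x : Q, x ^+ p = 1.
  by apply: (expg_cosetT) => // x; apply: (subsetP sML); apply: expgp_Mho.
have iQ : #|[set: Q] : [set: Q]^`(1)| = (p ^ 2)%N.
  by rewrite index_der1_cosetT //; apply: (lcn_subS 2).
have ntQ' : [set: Q]^`(1) != 1 by rewrite -cardG_gt1 oQ' prime_gt1.
have [c _ ncZ] : exists2 c, c \in [set: Q] & c \notin 'C([set: Q]).
  by apply/subsetPn; apply: contraNN ntQ' => /derG1P/eqP.
case/eqP: ntQ'; apply/derG1P/centsP=> x _ y _; apply/commgP/eqP.
apply: (poly_trivial_der1 p_prime expQ iQ (c := c) oQ' (n := 2)) => //.
- by move=> t; rewrite mem_commg ?inE.
- by rewrite inE inE.
- exact: subset_trans cQ' (centS (subsetT _)).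
- by rewrite mem_commg ?inE.
rewrite -(coset_reprK x) -(coset_reprK y) -coset_commg //.
by apply: poly_trivial_coset => // f; apply: dim_elt_polyfun.
Qed.

End WholeGroup.
End Obelisks.

(** * Transfer of the obelisk conditions along the isomorphism *)

Lemma power_subgroup_Mho (gT : finGroupType) (p : nat) (X : {group gT}) :
  (p.-group X)%g -> power_subgroup p X = 'Mho^1(X)%g.
Proof. by move=> pX; rewrite (MhoE 1 pX) expn1. Qed.

Theorem theorem5p3 (p : nat) (p_prime : prime p) (p_gt3 : (3 < p)%N)
  (G O : finGroupType)
  (pG : (p.-group [set: G])%g)
  (obO : is_obelisk p [set: O]%G)
  (isoGO : algebra_iso (group_algebra 'F_p G) (group_algebra 'F_p O)) :
  is_obelisk p [set: G]%G.
Proof.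
case: obO => pO nabO iO; rewrite power_subgroup_Mho // => MhoO.
have iG : #|[set: G] : [set: G]^`(1)|%g = (p ^ 2)%N.
  by rewrite (index_der1_algebra_iso p_prime isoGO).
(* If G' = 1, then |O : O'| = |G : G'| = |G| = |O|, which forces O' = 1. *)
have nabG : ~~ abelian [set: G].
  apply: contra nabO => /derG1P G'1.
  apply/derG1P/(@card1_trivg _ [set: O]^`(1)%G).
  have := Lagrange (der_sub 1 [set: O]); rewrite iO -iG G'1 indexg1 !cardsT.
  rewrite (card_algebra_iso p_prime isoGO) -{2}[#|O|]mul1n => /eqP.
  by rewrite eqn_pmul2r => [/eqP|]; last by rewrite -cardsT cardG_gt0.
have [f [f' [fK f'K]]] := algebra_iso_inverse isoGO.
have isoOG : algebra_iso (group_algebra 'F_p O) (group_algebra 'F_p G).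
  by exists f', f.
split=> //; rewrite power_subgroup_Mho //.
apply/eqP; rewrite eqEsubset; apply/andP; split.
  (* If all [x, y] - 1 lay in I^3 for G, the inverse isomorphism would give the same for O, against
     [dim_elt_commg_lcn3]. *)
  apply: (Mho_sub_lcn3 p_prime pG iG nabG); first exact: ltnW.
  move/(dim_elt_commg_algebra_iso p_prime pO pG isoOG).
  by apply: (dim_elt_commg_lcn3 p_prime pO iO nabO); rewrite MhoO.
(* In O every [x, y, z] lies in ['L_3], which equals ['Mho^1], so [x, y, z] - 1 is in I^p and hence
   in I^4. *)
apply: (lcn3_sub_Mho p_prime pG iG nabG).
apply: (dim_elt_commg3_algebra_iso p_prime pG pO isoGO) => x y z.
apply: (aug_pow_le p_gt3); apply: (dim_elt_Mho p_prime pO).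
by rewrite MhoO !mem_commg ?inE.
Qed.
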